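(* Let $L$ be any language, let $T^\emptyset_L$ be the model companion of the empty $L$-theory, and let $\mathbb{M}$ be a monster model of $T^\emptyset_L$. Then the relations $\perp^M$ and $\perp^d$ on small subsets of $\mathbb{M}$ satisfy extension over arbitrary sets: for $\perp$ either of these relations, and for all small $A,B,C,B'\subseteq\mathbb{M}$ with $A\perp_C B$, there exists $A'\equiv_{BC}A$ such that $A'\perp_C BB'$. Consequently $\perp^M=\perp^{\text{þ}}$ (thorn-forking independence) and $\perp^d=\perp^f$ (forking independence) in $\mathbb{M}$.
   Context: $T^\emptyset_L$ is the model companion of the empty theory in the language $L$ (it exists for every $L$ and axiomatizes the class of existentially closed $L$-structures). It need not be complete; a monster model $\mathbb{M}\models T^\emptyset_L$ is a monster model of an arbitrary completion. Algebraic independence: $A\perp^a_C B$ iff $\mathrm{acl}(AC)\cap\mathrm{acl}(BC)=\mathrm{acl}(C)$, with $\mathrm{acl}$ computed in $\mathbb{M}$ (real elements). $M$-dividing independence (the superscript $M$ is only a name): $A\perp^M_C B$ iff for all $C'$ with $C\subseteq C'\subseteq\mathrm{acl}(BC)$, $A\perp^a_{C'}B$. Dividing independence: $A\perp^d_C B$ iff $\mathrm{tp}(A/BC)$ contains no formula that divides over $C$, where $\varphi(x;b)$ divides over $C$ if there is a $C$-indiscernible sequence $(b_i)_{i<\omega}$ with $b_0=b$ and $\{\varphi(x;b_i):i<\omega\}$ inconsistent. $\perp^{\text{þ}}$ and $\perp^f$ are obtained from $\perp^M$ and $\perp^d$, respectively, by forcing extension (following Adler): $A\perp^{\text{þ}}_C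 B$ (resp. $A\perp^f_C B$) iff for every small $\widehat B\supseteq B$ there is $A'\equiv_{BC}A$ with $A'\perp^M_C\widehat B$ (resp. $A'\perp^d_C\widehat B$). The relation $\perp^f$ is the usual forking independence: $A\perp^f_C B$ iff $\mathrm{tp}(A/BC)$ does not fork over $C$. $A\equiv_D A'$ means that (some enumerations of) $A$ and $A'$ have the same type over $D$. *)

(* Defs.v *)
From mathcomp Require Import all_boot.
From mathcomp Require Import boolp classical_sets functions cardinality.
Set Implicit Arguments. Unset Strict Implicit. Unset Printing Implicit Defensive.
Local Open Scope classical_set_scope.
Local Open Scope card_scope.

Record language := Language {
  fsym : Type;
  farity : fsym -> nat;
  rsym : Type;
  rarity : rsym -> nat }.

(* [term L X] and [formula L X]: free variables in the arbitrary type [X]; a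
   quantifier binds the variable [None] of its body. *)
Inductive term (L : language) (X : Type) : Type :=
| tvar of X
| tapp (f : fsym L) of ('I_(farity f) -> term L X).

Inductive formula (L : language) (X : Type) : Type :=
| fbot
| feq of term L X & term L X
| frel (r : rsym L) of ('I_(rarity r) -> term L X)
| fimp of formula L X & formula L X
| fall of formula L (option X).

Definition sentence (L : language) := formula L void.
Definition theory (L : language) := set (sentence L).

Record structure (L : language) := Structure {
  carrier :> Type;
  finterp : forall f : fsym L, ('I_(farity f) -> carrier) -> carrier;
  rinterp : forall r : rsym L, ('I_(rarity r) -> carrier) -> Prop;
  carrier_inhabited : inhabited carrier }.
Arguments finterp {L} s f a.
Arguments rinterp {L} s r a.

Definition scons (T X : Type) (m : T) (v : X -> T) (o : option X) : T :=
  if o is Some x then v x else m.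

Definition sjoin (T X Y : Type) (v : X -> T) (w : Y -> T) (z : X + Y) : T :=
  match z with inl x => v x | inr y => w y end.

Fixpoint teval (L : language) (M : structure L) (X : Type) (v : X -> M)
    (t : term L X) : M :=
  match t with
  | tvar x => v x
  | tapp f ts => finterp M f (fun i => teval v (ts i))
  end.

Fixpoint sat (L : language) (M : structure L) (X : Type) (phi : formula L X) :
    (X -> M) -> Prop :=
  match phi with
  | fbot => fun _ => False
  | feq s t => fun v => teval v s = teval v t
  | frel r ts => fun v => rinterp M r (fun i => teval v (ts i))
  | fimp phi psi => fun v => sat phi v -> sat psi v
  | fall phi => fun v => forall m : M, sat phi (scons m v)
  end.

Definition models (L : language) (T : theory L) (M : structure L) : Prop :=
  forall phi, T phi -> sat phi (@of_void M).

Record embedding (L : language) (M N : structure L) (h : M -> N) : Prop := {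
  embedding_inj : injective h;
  embedding_fun : forall (f : fsym L) (a : 'I_(farity f) -> M),
    h (finterp M f a) = finterp N f (h \o a);
  embedding_rel : forall (r : rsym L) (a : 'I_(rarity r) -> M),
    rinterp M r a <-> rinterp N r (h \o a) }.

Definition elementary (L : language) (M N : structure L) (h : M -> N) : Prop :=
  forall n (phi : formula L 'I_n) (a : 'I_n -> M),
    sat phi a <-> sat phi (h \o a).

Definition model_complete (L : language) (T : theory L) : Prop :=
  forall (M N : structure L) (h : M -> N),
    models T M -> models T N -> embedding h -> elementary h.

Definition embeds_in_model (L : language) (T : theory L) (M : structure L) :
    Prop :=
  exists (N : structure L) (h : M -> N), models T N /\ embedding h.

Definition model_companion (L : language) (Tstar T : theory L) : Prop :=
  [/\ model_complete Tstar,
      forall M : structure L, models T M -> embeds_in_model Tstar M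
    & forall M : structure L, models Tstar M -> embeds_in_model T M].

Section Types.
Variables (L : language) (M : structure L).
Implicit Types (A B C D : set M).

Definition formula_over (X : Type) D := formula L (X + D).

Definition holds (X : Type) D (phi : formula_over X D) (v : X -> M) : Prop :=
  sat phi (sjoin v val).

Definition tp (X : Type) (e : X -> M) D : set (formula_over X D) :=
  [set phi | holds phi e].
Arguments tp {X} e D _.

(* A ≡_D A': some enumerations of A and A' have the same type over D. *)
Definition equiv_over D A A' : Prop :=
  exists (I : Type) (e e' : I -> M),
    [/\ range e = A, range e' = A' & tp e D = tp e' D].

Definition automorphism (s : M -> M) : Prop := bijective s /\ embedding s.

Definition acl A : set M :=
  [set m | exists phi : formula_over unit A,
     holds phi (fun=> m) /\ finite_set [set m' | holds phi (fun=> m')]].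

End Types.
Arguments tp {L M X} e D _.

(* The cardinal kappa is represented by a type of cardinality kappa. *)
Definition small (kappa T : Type) (A : set T) : Prop :=
  ~ ([set: kappa] #<= A).

Definition saturated (kappa : Type) (L : language) (M : structure L) : Prop :=
  forall (D : set M) (p : set (formula_over unit D)),
    small kappa D ->
    (forall q, finite_set q -> q `<=` p ->
       exists m : M, forall phi, q phi -> holds phi (fun=> m)) ->
    exists m : M, forall phi, p phi -> holds phi (fun=> m).

Definition strongly_homogeneous (kappa : Type) (L : language)
    (M : structure L) : Prop :=
  forall (I : Type) (e e' : I -> M),
    small kappa (range e) -> tp e set0 = tp e' set0 ->
    exists s : M -> M, automorphism s /\ s \o e = e'.

(* The second clause says kappa > |L| + aleph_0. *)
Definition monster (kappa : Type) (L : language) (T : theory L)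
    (M : structure L) : Prop :=
  [/\ models T M,
      small kappa [set: (fsym L + rsym L + nat)%type],
      saturated kappa M
    & strongly_homogeneous kappa M].

(* In all the ternary relations below the base comes first: [R C A B] is
   read "A is independent from B over C". *)
Section Independence.
Variables (L : language) (M : structure L).
Implicit Types (A B C : set M).

Definition indep_a C A B : Prop :=
  acl (A `|` C) `&` acl (B `|` C) = acl C.

Definition indep_M C A B : Prop :=
  forall C', C `<=` C' -> C' `<=` acl (B `|` C) -> indep_a C' A B.

Definition increasing n (s : 'I_n -> nat) : Prop :=
  forall i j : 'I_n, i < j -> s i < s j.

Definition indiscernible C (Y : Type) (b : nat -> Y -> M) : Prop :=
  forall n (s t : 'I_n -> nat), increasing s -> increasing t ->
    tp (fun p : 'I_n * Y => b (s p.1) p.2) C =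
    tp (fun p : 'I_n * Y => b (t p.1) p.2) C.

(* phi(x; b) divides over C.  As M is a monster model, the countable set
   {phi(x; b_i) : i < omega} is inconsistent iff it is not realized in M. *)
Definition divides C n m (phi : formula L ('I_n + 'I_m)) (b : 'I_m -> M) :
    Prop :=
  exists bs : nat -> 'I_m -> M,
    [/\ indiscernible C bs, bs 0 = b
      & ~ exists a : 'I_n -> M, forall i, sat phi (sjoin a (bs i))].

Definition indep_d C A B : Prop :=
  forall n m (phi : formula L ('I_n + 'I_m)) (a : 'I_n -> M) (b : 'I_m -> M),
    (forall i, A (a i)) -> (forall j, (B `|` C) (b j)) ->
    sat phi (sjoin a b) -> ~ divides C phi b.

Variable kappa : Type.

Definition extension (R : set M -> set M -> set M -> Prop) : Prop :=
  forall A B C B',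
    small kappa A -> small kappa B -> small kappa C -> small kappa B' ->
    R C A B ->
    exists A', equiv_over (B `|` C) A A' /\ R C A' (B `|` B').

Definition force_extension (R : set M -> set M -> set M -> Prop) C A B :
    Prop :=
  forall Bhat, small kappa Bhat -> B `<=` Bhat ->
    exists A', equiv_over (B `|` C) A A' /\ R C A' Bhat.

Definition indep_thorn := force_extension indep_M.
Definition indep_f := force_extension indep_d.

End Independence.

(* Main.v *)
Require Import Defs.
From mathcomp Require Import all_boot.
From mathcomp Require Import boolp classical_sets functions cardinality.
Set Implicit Arguments. Unset Strict Implicit. Unset Printing Implicit Defensive.
Local Open Scope classical_set_scope.
Local Open Scope card_scope.

(* Every L-structure embeds in a model of T and embeddings between models of T
   are elementary, so any amalgam of L-structures can be used to compute types,
   and partial isomorphisms between models of T that are closed under the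
   functions preserve all formulas.  Amalgams are built by gluing the pieces as
   partial structures and sending all remaining function values to one new point.
   Amalgamating copies of M over a closed set gives acl A = <A>.

   Extension for M-dividing independence: amalgamate two copies of M over <BC>,
   take A in the first and BB' in the second, and realize A over BB'C in M; a
   function applied to a genuinely mixed tuple takes the new value, so <A'C'>
   meets <BB'C> in <C'> only.

   The two relations coincide on small sets.  If x in <AC'> and <BC> is not in
   <C'>, then in infinitely many copies of M over <C'> the copies of x are
   distinct, and a formula expressing x by A and C' divides.  Conversely, let b
   be in BC, (b_i) C-indiscernible and E the set of elements of <b> that are
   constant along the sequence.  M-dividing independence at base CE gives that
   <a,E> meets <b> in E, so copies of <a,b>, one for each b_i, can be glued along
   <a,E> and on top of M: this yields a common realization. *)

(** * Renaming of variables, and the variables that occur in terms and formulas *)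

Section Syntax.
Variable L : language.

Fixpoint tmap (X Y : Type) (r : X -> Y) (t : term L X) : term L Y :=
  match t with
  | tvar x => tvar L (r x)
  | tapp f ts => tapp (fun i => tmap r (ts i))
  end.

Fixpoint fmap (X Y : Type) (r : X -> Y) (phi : formula L X) : formula L Y :=
  match phi with
  | fbot => fbot L Y
  | feq s t => feq (tmap r s) (tmap r t)
  | Defs.frel _ ts => Defs.frel (fun i => tmap r (ts i))
  | fimp phi psi => fimp (fmap r phi) (fmap r psi)
  | fall phi => fall (fmap (omap r) phi)
  end.

Fixpoint tvars (X : Type) (t : term L X) : set X :=
  match t with
  | tvar x => [set x]
  | tapp f ts => \bigcup_i tvars (ts i)
  end.

Fixpoint fvars (X : Type) (phi : formula L X) : set X :=
  match phi with
  | fbot => set0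
  | feq s t => tvars s `|` tvars t
  | Defs.frel _ ts => \bigcup_i tvars (ts i)
  | fimp phi psi => fvars phi `|` fvars psi
  | fall phi => some @^-1` fvars phi
  end.

Lemma finite_tvars X (t : term L X) : finite_set (tvars t).
Proof.
elim: t => [x|f ts IH] /=; first exact: finite_set1.
by apply: bigcup_finite => // ; exact: finite_finset.
Qed.

Lemma finite_fvars X (phi : formula L X) : finite_set (fvars phi).
Proof.
elim: phi => {X} [X|X s t|X r ts|X phi IH psi IH'|X phi IH] /=.
- exact: finite_set0.
- by rewrite finite_setU; split; exact: finite_tvars.
- by apply: bigcup_finite => [|i _]; [exact: finite_finset|exact: finite_tvars].
- by rewrite finite_setU.
- by apply: finite_preimage => // x y _ _ [].
Qed.

Lemma teval_ext (M : structure L) X (t : term L X) (v w : X -> M) :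
  {in tvars t, v =1 w} -> teval v t = teval w t.
Proof.
elim: t => [x|f ts IH] /= vw; first by apply: vw; rewrite inE.
congr finterp; apply/funext => i; apply: IH => x; rewrite inE => tx.
by apply: vw; rewrite inE; exists i.
Qed.

Lemma sat_ext (M : structure L) X (phi : formula L X) (v w : X -> M) :
  {in fvars phi, v =1 w} -> sat phi v <-> sat phi w.
Proof.
elim: phi v w => {X} [X|X s t|X r ts|X phi IH psi IH'|X phi IH] v w //= vw.
- by rewrite !(@teval_ext _ _ _ v w) // => x xs; apply: vw; rewrite !inE in xs *;
    [right|left].
- suff -> : (fun i => teval v (ts i)) = fun i => teval w (ts i) by [].
  apply/funext => i; apply: teval_ext => x; rewrite inE => tx.
  by apply: vw; rewrite inE; exists i.
- rewrite (IH v w) ?(IH' v w) // => x xs; apply: vw; rewrite !inE in xs *;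
    by [right|left].
- suff H m : sat phi (scons m v) <-> sat phi (scons m w).
    by split=> + m => /(_ m); rewrite H.
  by apply: IH => -[x|] //=; rewrite inE => px; apply: vw; rewrite inE.
Qed.

Lemma teval_tmap (M : structure L) X Y (r : X -> Y) (t : term L X)
  (v : Y -> M) : teval v (tmap r t) = teval (v \o r) t.
Proof. by elim: t => [//|f ts IH] /=; congr finterp; apply/funext. Qed.

Lemma sat_fmap (M : structure L) X Y (r : X -> Y) (phi : formula L X)
  (v : Y -> M) : sat (fmap r phi) v <-> sat phi (v \o r).
Proof.
elim: phi Y r v => {X} [X|X s t|X R ts|X phi IH psi IH'|X phi IH] Y r v //=.
- by rewrite !teval_tmap.
- by under eq_fun do rewrite teval_tmap.
- by rewrite IH IH'.
- suff H m : sat (fmap (omap r) phi) (scons m v) <-> sat phi (scons m (v \o r)).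
    by split=> + m => /(_ m); rewrite H.
  by rewrite IH; apply: sat_ext => -[].
Qed.

End Syntax.

(** Serves to trade a formula in arbitrary variables for one in the variables ['I_n], the form in
    which [elementary] and [divides] are stated. *)
Lemma finite_set_code X (S : set X) : finite_set S ->
  exists n (r : X -> 'I_n) (e : 'I_n -> X), {in S, cancel r e}.
Proof.
have [[x0]|noX] := pselect (inhabited X); last first.
  have r (x : X) : 'I_0 by case: noX.
  have e (i : 'I_0) : X by case: i.
  by exists 0, r, e => x; case: noX.
move=> /(@finite_seqP {classic X})[s ->].
(* The successor makes [inord] available even when [s] is empty. *)
exists (size s).+1, (fun x : {classic X} => inord (index x s)).
exists (fun i => nth x0 s i).
move=> x; rewrite inE /= => xs.
rewrite inordK ?ltnS ?index_size//; exact: (@nth_index {classic X}).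
Qed.

(** * Elementary relations, partial isomorphisms and generated substructures *)

Section Relations.
Variables (L : language).
Implicit Types (M N Q : structure L).

(** Partial elementary maps as relations, so that embeddings, types of tuples and fixed parameters
    can be combined by disjunction. Applied to equality, the condition makes [r] a bijection between
    its domain and its range. *)
Definition elem_rel M N (r : M -> N -> Prop) : Prop :=
  forall n (phi : formula L 'I_n) v w, (forall i, r (v i) (w i)) ->
    sat phi v <-> sat phi w.

Definition graph M N (h : M -> N) : M -> N -> Prop := fun x y => y = h x.

(** Domain and range are closed under the functions, so this is an isomorphism between
    substructures, empty ones allowed. *)
Record partial_iso M N (r : M -> N -> Prop) : Prop := {
  partial_iso_eq : forall x x' y y', r x y -> r x' y' -> x = x' <-> y = y';
  partial_iso_fun : forall (f : Defs.fsym L) a b, (forall i, r (a i) (b i)) ->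
    r (finterp M f a) (finterp N f b);
  partial_iso_rel : forall (R : rsym L) a b, (forall i, r (a i) (b i)) ->
    rinterp M R a <-> rinterp N R b }.

Inductive gen M N (r : M -> N -> Prop) : M -> N -> Prop :=
| gen_base x y of r x y : gen r x y
| gen_app f a b of (forall i, gen r (a i) (b i)) :
    gen r (finterp M f a) (finterp N f b).

Inductive hull M (A : set M) : M -> Prop :=
| hull_base x of A x : hull A x
| hull_app f a of (forall i, hull A (a i)) : hull A (finterp M f a).

Lemma sat_elem_rel M N (r : M -> N -> Prop) : elem_rel r ->
  forall X (phi : formula L X) v w, (forall x, r (v x) (w x)) ->
    sat phi v <-> sat phi w.
Proof.
move=> rE X phi v w vw.
have [n [c [e ecK]]] := finite_set_code (finite_fvars phi).
have satE (Q : structure L) (u : X -> Q) :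
    sat phi u <-> sat (fmap c phi) (u \o e).
  by rewrite sat_fmap; apply: sat_ext => x /ecK /= ->.
by rewrite !satE; apply: rE => i; apply: vw.
Qed.

Lemma elem_rel_elementary M N (h : M -> N) : elementary h -> elem_rel (graph h).
Proof.
move=> hE n phi v w vw; rewrite (hE _ phi v).
by suff -> : w = h \o v by []; apply/funext => i; apply: vw.
Qed.

Lemma sub_elem_rel M N (r r' : M -> N -> Prop) :
  (forall x y, r x y -> r' x y) -> elem_rel r' -> elem_rel r.
Proof. by move=> rr' r'E n phi v w vw; apply: r'E => i; apply: rr'. Qed.

Lemma embedding_teval M N (h : M -> N) : embedding h ->
  forall X (t : term L X) (v : X -> M), teval (h \o v) t = h (teval v t).
Proof.
move=> hE X t v; elim: t => [//|f ts IH] /=.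
by rewrite (embedding_fun hE); congr finterp; apply/funext.
Qed.

Lemma gen_termP M N Z (v : Z -> M) (w : Z -> N) x y :
  gen (fun x y => exists2 z, x = v z & y = w z) x y <->
  exists t : term L Z, x = teval v t /\ y = teval w t.
Proof.
split=> [|[t [-> ->]]]; last first.
  elim: t => [z|f ts IH] /=; first by apply: gen_base; exists z.
  exact: gen_app.
elim=> [_ _ [z -> ->]|f a b _ IH]; first by exists (tvar L z).
have [ts tsP] := choice IH.
exists (tapp ts) => /=.
by split; congr finterp; apply/funext => i; have [] := tsP i.
Qed.

Lemma gen_sub M N (r r' : M -> N -> Prop) :
  (forall x y, r x y -> r' x y) -> forall x y, gen r x y -> gen r' x y.
Proof.
by move=> rr' x y; elim=> [{}x {}y /rr'|f a b _ IH];
  [exact: gen_base|exact: gen_app].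
Qed.

(** Taking the pairs of [r] themselves as variables lets one term describe both coordinates. *)
Lemma gen_term M N (r : M -> N -> Prop) x y : gen r x y ->
  exists t : term L {p : M * N | r p.1 p.2},
    x = teval (fun p => (sval p).1) t /\ y = teval (fun p => (sval p).2) t.
Proof.
move=> rxy; apply/gen_termP; apply: gen_sub rxy => {}x {}y rxy.
by exists (exist _ (x, y) rxy).
Qed.

(** Equalities and relations between values of terms are formulas in the generators, so an
    elementary relation respects them. *)
Lemma partial_iso_gen M N (r : M -> N -> Prop) :
  elem_rel r -> partial_iso (gen r).
Proof.
move=> /sat_elem_rel rE; split.
- move=> x x' y y' /gen_term[t [-> ->]] /gen_term[t' [-> ->]].
  by apply: (rE _ (feq t t')) => p; exact: (svalP p).
- exact: gen_app.
- move=> R a b ab; have [ts tsP] := choice (fun i => gen_term (ab i)).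
  have -> : a = fun i => teval (fun p => (sval p).1) (ts i).
    by apply/funext => i; have [] := tsP i.
  have -> : b = fun i => teval (fun p => (sval p).2) (ts i).
    by apply/funext => i; have [] := tsP i.
  by apply: (rE _ (Defs.frel ts)) => p; exact: (svalP p).
Qed.

Lemma elem_rel_eq M N (r : M -> N -> Prop) x x' y y' : elem_rel r ->
  r x y -> r x' y' -> x = x' <-> y = y'.
Proof.
move=> rE xy x'y'; apply: (partial_iso_eq (partial_iso_gen rE)); exact: gen_base.
Qed.

Lemma hull_term M (A : set M) x : hull A x ->
  exists t : term L A, x = teval val t.
Proof.
elim=> [{}x Ax|f a _ IH]; first by exists (tvar L (SigSub (mem_set Ax))).
have [ts tsP] := choice IH; exists (tapp ts) => /=.
by congr finterp; apply/funext.
Qed.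

Lemma hull_teval M X (A : set M) (v : X -> M) (t : term L X) :
  (forall x, A (v x)) -> hull A (teval v t).
Proof.
by move=> Av; elim: t => [x|f ts IH] /=; [exact/hull_base|exact/hull_app].
Qed.

Lemma hull_sub M (A B : set M) : A `<=` hull B -> hull A `<=` hull B.
Proof.
by move=> AB x; elim=> [{}x /AB//|f a _ IH]; exact: hull_app.
Qed.

Lemma hull_closed M (A : set M) : hull (hull A) `<=` hull A.
Proof. exact: hull_sub. Qed.

Lemma hullS M (A B : set M) : A `<=` B -> hull A `<=` hull B.
Proof. by move=> AB; apply: hull_sub => x /AB; exact: hull_base. Qed.

End Relations.

(** * Gluing structures along common points *)

Section Glue.
Variables (L : language) (K P : Type) (S : K -> structure L).
Variable g : forall k, S k -> P.
Arguments g : clear implicits.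
Hypothesis g_inj : forall k, injective (g k).
Hypothesis g_fun : forall k l (f : Defs.fsym L) x y,
  (forall i, g k (x i) = g l (y i)) ->
  g k (finterp (S k) f x) = g l (finterp (S l) f y).
Hypothesis g_rel : forall k l (R : rsym L) x y,
  (forall i, g k (x i) = g l (y i)) ->
  rinterp (S k) R x -> rinterp (S l) R y.

(* [None] collects the values of the functions that no piece determines. *)
Definition glue : structure L := @Structure L (option P)
  (fun f z =>
    if pselect (exists p k x, z = some \o g k \o x /\
                  p = Some (g k (finterp (S k) f x))) is left e
    then projT1 (cid e) else None)
  (fun R z => exists k x, z = some \o g k \o x /\ rinterp (S k) R x)
  (inhabits None).

Definition glue_in k : S k -> glue := some \o g k.

Lemma glue_in_eq k l n (x : 'I_n -> S k) (y : 'I_n -> S l) :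
  @glue_in k \o x = @glue_in l \o y -> forall i, g k (x i) = g l (y i).
Proof. by move=> xy i; have [] := congr1 (@^~ i) xy. Qed.

(** By [g_fun] the value picked by [cid] does not depend on the piece that witnesses it, and by
    [g_rel] a relation that holds in one piece holds in every piece containing the tuple. *)
Lemma embedding_glue_in k : embedding (@glue_in k).
Proof.
split=> [x y [/g_inj//]|f a|R a] /=.
- case: pselect => [e|[]]; last by exists (Some (g k (finterp (S k) f a))), k, a.
  case: cid => /= p [l [x [/glue_in_eq ax ->]]].
  by rewrite /glue_in /=; congr Some; apply: g_fun.
- split=> [Ra|[l [x [/glue_in_eq ax Rx]]]]; first by exists k, a.
  by apply: g_rel Rx => i; rewrite ax.
Qed.

Lemma glue_fun f (z : 'I_(farity f) -> glue) :
  (exists k x, z = @glue_in k \o x) \/ finterp glue f z = None.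
Proof.
rewrite /=; case: pselect => [e|_]; last by right.
by case: cid => /= p [k [x [zE _]]]; left; exists k, x.
Qed.

End Glue.

(** * Amalgamation of structures and of models of the companion *)

Section Amalgam.
Variable L : language.
Implicit Types (M N Q : structure L).

Lemma amalgam M N (r : M -> N -> Prop) : partial_iso r ->
  exists (Q : structure L) (i : M -> Q) (j : N -> Q),
    [/\ embedding i, embedding j & forall x y, r x y -> i x = j y].
Proof.
move=> [r_eq r_fun r_rel].
pose S (b : bool) := if b then M else N.
(* A point of [N] related to a point of [M] takes the name of that point; this turns the disjoint
   sum into an amalgam. *)
pose gN (y : N) : M + N :=
  if pselect (exists x, r x y) is left e then inl (projT1 (cid e)) else inr y.
have gNE x y : r x y -> gN y = inl x.
  rewrite /gN => rxy; case: pselect => [e|[]]; last by exists x.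
  by case: cid => x' rx'y /=; congr inl; exact/(r_eq _ _ _ _ rx'y rxy).
have gNI x y : gN y = inl x -> r x y.
  by rewrite /gN; case: pselect => //= e; case: cid => /= x' + [<-].
have gN_inj : injective gN.
  move=> y y'; case E : (gN y) => [x|z].
    by move=> /esym /gNI rxy'; exact/(r_eq _ _ _ _ (gNI _ _ E) rxy').
  move: E; rewrite /gN; case: pselect => // _ [->]; case: pselect => // _ [].
  by [].
pose g b : S b -> M + N :=
    match b return S b -> M + N with true => @inl M N | false => gN end.
have g_inj b : injective (g b) by case: b => // x y [].
have g_fun b c f x y : (forall i, g b (x i) = g c (y i)) ->
    g b (finterp (S b) f x) = g c (finterp (S c) f y).
  case: b c x y => -[] x y /= xy.
  - by congr (inl (finterp _ _ _)); apply/funext => i; have [] := xy i.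
  - by apply/esym/gNE/r_fun => i; apply: gNI; rewrite -xy.
  - by apply/gNE/r_fun => i; apply: gNI; rewrite xy.
  - by congr (gN (finterp _ _ _)); apply/funext => i; have /gN_inj := xy i.
have g_rel b c R x y : (forall i, g b (x i) = g c (y i)) ->
    rinterp (S b) R x -> rinterp (S c) R y.
  case: b c x y => -[] x y /= xy.
  - by have -> : x = y by apply/funext => i; have [] := xy i.
  - by apply r_rel => i; apply: gNI; rewrite -xy.
  - by apply r_rel => i; apply: gNI; rewrite xy.
  - by have -> : x = y by apply/funext => i; have /gN_inj := xy i.
exists (glue g), (@glue_in _ _ _ _ g true), (@glue_in _ _ _ _ g false).
split; [exact: (embedding_glue_in g_inj g_fun g_rel true)
       |exact: (embedding_glue_in g_inj g_fun g_rel false)|].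
by move=> x y /gNE rxy; rewrite /glue_in /= rxy.
Qed.

Variables (T : theory L) (hT : model_companion T set0).

Lemma embeds_in_companion M :
  exists2 Q : structure L, models T Q & exists h : M -> Q, embedding h.
Proof.
have [_ /(_ M)[//|Q [h [TQ hE]]] _] := hT.
by exists Q => //; exists h.
Qed.

Lemma embedding_elementary M N (h : M -> N) :
  models T M -> models T N -> embedding h -> elem_rel (graph h).
Proof.
by move=> TM TN hE; apply: elem_rel_elementary; have [mc _ _] := hT; exact: mc.
Qed.

Lemma embedding_comp M N Q (h : M -> N) (k : N -> Q) :
  embedding h -> embedding k -> embedding (k \o h).
Proof.
move=> [hi hf hr] [ki kf kr]; split; first exact: inj_comp.
  by move=> f a /=; rewrite hf kf.
by move=> R a; rewrite hr kr.
Qed.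

Lemma amalgam_companion M N (r : M -> N -> Prop) : partial_iso r ->
  exists (Q : structure L) (i : M -> Q) (j : N -> Q),
    [/\ models T Q, embedding i, embedding j & forall x y, r x y -> i x = j y].
Proof.
move=> /amalgam[Q0 [i [j [iE jE ij]]]].
have [Q TQ [h hE]] := embeds_in_companion Q0.
exists Q, (h \o i), (h \o j); split => //; try exact: embedding_comp.
by move=> x y /ij /= ->.
Qed.

(** Related tuples become one tuple in an amalgam that models [T], and both embeddings into it are
    elementary by model completeness. *)
Lemma partial_iso_elem_rel M N (r : M -> N -> Prop) :
  models T M -> models T N -> partial_iso r -> elem_rel r.
Proof.
move=> TM TN /amalgam_companion[Q [i [j [TQ iE jE ij]]]] n phi v w vw.
have -> : sat phi v <-> sat phi (i \o v) by exact: (embedding_elementary TM TQ iE).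
have -> : sat phi w <-> sat phi (j \o w) by exact: (embedding_elementary TN TQ jE).
by have -> : i \o v = j \o w by apply/funext => k; exact: ij.
Qed.

End Amalgam.
Arguments embedding_elementary {L T} hT {M N h} _ _ _.

(** * Cardinal arithmetic: comparability, doubling, small sets *)

Lemma card_le_relP T U (A : set T) (B : set U) :
  A #<= B <-> exists r : T -> U -> Prop,
    (forall x, A x -> exists2 y, B y & r x y) /\
    (forall x x' y, A x -> A x' -> r x y -> r x' y -> x = x').
Proof.
split=> [/card_leP[f]|[r [rex rinj]]].
  exists (fun x y => exists a : A, x = val a /\ y = val (f a)).
  split=> [x Ax|x x' _ _ _ [a [-> ->]] [a' [-> /val_inj]]].
    exists (val (f (SigSub (mem_set Ax)))); first exact/set_mem/valP.
    by exists (SigSub (mem_set Ax)).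
  by move=> ff'; congr val; apply: (@inj _ _ _ f); rewrite ?inE.
have /choice[f fP] (a : A) : exists y, B y /\ r (val a) y.
  by have [y] := rex (val a) (set_mem (valP a)); exists y.
have fB a : f a \in B by rewrite inE; have [] := fP a.
apply/card_leP/injfunPex; exists (fun a => SigSub (fB a)) => // a a' _ _ [ff'].
apply: val_inj; apply: (rinj _ _ (f a)); try exact/set_mem/valP.
  by have [] := fP a.
by rewrite ff'; have [] := fP a'.
Qed.

(** Zorn on partial bijections between [A] and [B]: a maximal one exhausts one side, or else a
    further pair could be added. *)
Lemma card_le_total T U (A : set T) (B : set U) : A #<= B \/ B #<= A.
Proof.
pose P (G : set (T * U)) :=
  (forall p, G p -> A p.1 /\ B p.2) /\
  (forall p q, G p -> G q -> p.1 = q.1 <-> p.2 = q.2).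
have [F FP Ftot|G [[GAB Ginj] Gmax]] := @Zorn_bigcup _ P.
  split=> [p [X FX Xp]|p q [X FX Xp] [Y FY Yq]]; first exact: (FP _ FX).1.
  have [/(_ _ Xp)|/(_ _ Yq)] := Ftot _ _ FX FY => H.
    exact: (FP _ FY).2.
  exact: (FP _ FX).2.
have [AG|/existsNP[x0 /not_implyP[Ax0 nx0]]] :=
  pselect (forall x, A x -> exists y, G (x, y)).
  left; apply/card_le_relP; exists (fun x y => G (x, y)); split.
    by move=> x /AG[y Gxy]; exists y => //; have [] := GAB _ Gxy.
  by move=> x x' y _ _ Gx Gx'; apply/(Ginj _ _ Gx Gx').
have [BG|/existsNP[y0 /not_implyP[By0 ny0]]] :=
  pselect (forall y, B y -> exists x, G (x, y)).
  right; apply/card_le_relP; exists (fun y x => G (x, y)); split.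
    by move=> y /BG[x Gxy]; exists x => //; have [] := GAB _ Gxy.
  by move=> y y' x _ _ Gy Gy'; apply/(Ginj _ _ Gy Gy').
exfalso; apply: (Gmax (G `|` [set (x0, y0)])).
  split=> [|sub]; first exact: subsetUl.
  by apply: nx0; exists y0; apply: sub; right.
split=> [p [/GAB//|->//]|[x y] [x' y'] [Gp|[-> ->]] [Gq|[-> ->]]] //=.
- exact: Ginj Gp Gq.
- by split=> xy; subst; [case: nx0; exists y|case: ny0; exists x].
- by split=> xy; subst; [case: nx0; exists y'|case: ny0; exists x'].
Qed.

(** Zorn on injections of two copies of some [S] inside [A] into [S]. For a maximal one the rest of
    [A] is finite, so [A] injects into [S], and then two copies of [A] do. *)
Lemma card_le_double T (A : set T) : infinite_set A -> A `*` [set: bool] #<= A.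
Proof.
move=> Ainf.
pose P (G : set ((T * bool) * T)) :=
  [/\ forall p, G p -> A p.1.1 /\ A p.2,
      forall p q, G p -> G q -> p.1 = q.1 <-> p.2 = q.2,
      forall p b, G p -> exists z, G (p.1.1, b, z)
    & forall p b, G p -> exists z, G (p.2, b, z)].
have [F FP Ftot|G [[GA Ginj Gdom Gran] Gmax]] := @Zorn_bigcup _ P.
  split=> [p [X FX Xp]|p q [X FX Xp] [Y FY Yq]|p b [X FX Xp]|p b [X FX Xp]].
  - by have [+ _ _ _] := FP _ FX; apply.
  - have [/(_ _ Xp)|/(_ _ Yq)] := Ftot _ _ FX FY => H.
      by have [_ + _ _] := FP _ FY; apply.
    by have [_ + _ _] := FP _ FX; apply.
  - by have [_ _ /(_ _ b Xp)[z ?] _] := FP _ FX; exists z, X.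
  - by have [_ _ _ /(_ _ b Xp)[z ?]] := FP _ FX; exists z, X.
pose S := [set x | exists y, G (x, true, y)].
have GS x b y : G (x, b, y) -> S x by move=> /(Gdom _ true).
have SA : S `<=` A by move=> x [y /GA[]].
have GS2 x b y : G (x, b, y) -> S y by move=> /(Gran _ true).
have SG x b : S x -> exists2 z, S z & G (x, b, z).
  by move=> [y /(Gdom _ b)[z /= Gz]]; exists z => //; apply: GS2 Gz.
have ASfin : finite_set (A `\` S).
  apply: contrapT => /infiniteP /card_le_relP[r [rex rinj]].
  have /choice[f fP] n : exists y, (A `\` S) y /\ r n y.
    by have [y] := rex n I; exists y.
  have fA n : A (f n) by have [[]] := fP n.
  have fS n : ~ S (f n) by have [[]] := fP n.
  have finj : injective f.
    move=> n n' E; apply: (rinj _ _ (f n)) => //; first by have [] := fP n.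
    by rewrite E; have [] := fP n'.
  (* An infinite remainder would contain a sequence [f], on which [f n] with tag [b] can go to
     [f (2n + b)]. *)
  pose H := [set p | exists n (b : bool), p = (f n, b, f (b + n.*2)%N)].
  apply: (Gmax (G `|` H)).
    split=> [|sub]; first exact: subsetUl.
    have /GS : G (f 0, false, f 0) by apply: sub; right; exists 0, false.
    exact: fS.
  split.
  - by move=> p [/GA//|[n [b ->]]]; split; apply: fA.
  - move=> [[x b] y] [[x' b'] y'] [Gp|[n [c [-> -> ->]]]] [Gq|[m [d [-> -> ->]]]] /=.
    + exact: Ginj Gp Gq.
    + by split=> [[E _]|E]; [move/GS: Gp|move/GS2: Gp]; rewrite E => /fS.
    + by split=> [[E _]|E]; [move/GS: Gq|move/GS2: Gq]; rewrite -E => /fS.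
    + split=> [[/finj -> ->]//|/finj E].
      have E1 := congr1 odd E; have E2 := congr1 half E.
      move: E1 E2; rewrite !oddD !odd_double !addbF !oddb !half_bit_double.
      by move=> -> ->.
  - move=> p b [/(Gdom _ b)[z Gz]|[n [c ->]]]; first by exists z; left.
    by exists (f (b + n.*2)%N); right; exists n, b.
  - move=> p b [/(Gran _ b)[z Gz]|[n [c ->]]]; first by exists z; left.
    by exists (f (b + (c + n.*2).*2)%N); right; exists (c + n.*2)%N, b.
have Sinf : infinite_set S.
  move=> Sfin; apply: Ainf; apply: (@sub_finite_set _ _ (S `|` (A `\` S))).
    by move=> x Ax; have [|nS] := pselect (S x); [left|right].
  by rewrite finite_setU.
have /card_le_relP[e [eex einj]] : A `\` S #<= S.
  by apply: card_le_trans (finite_set_countable ASfin) _; apply/infiniteP.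
(* This sends [A] into [S]: points of [S] along the tag [true], the finitely many others through [e]
   and the tag [false]. *)
pose r x z := (S x /\ G (x, true, z)) \/
              exists2 y, (A `\` S) x /\ S y & e x y /\ G (y, false, z).
apply/card_le_relP; exists (fun p z => exists2 y, r p.1 y & G (y, p.2, z)); split.
  move=> [x b] [/= Ax _].
  have [y Sy rxy] : exists2 y, S y & r x y.
    have [Sx|nSx] := pselect (S x).
      by have [z Sz Gz] := SG _ true Sx; exists z => //; left.
    have [y Sy exy] := eex x (conj Ax nSx).
    by have [z Sz Gz] := SG _ false Sy; exists z => //; right; exists y.
  by have [z /SA Az Gz] := SG _ b Sy; exists z => //; exists y.
move=> [x b] [x' b'] z _ _ [y /= rxy Gy] [y' rxy' Gy'].
have /(Ginj _ _ Gy Gy')[yy' ->] : z = z by []; subst y'.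
congr (_, _).
case: rxy rxy' => [[Sx G1]|[u [Ax Su] [exu G1]]] [[Sx' G2]|[u' [Ax' Su'] [exu' G2]]].
- by have /(Ginj _ _ G1 G2)[] : y = y by [].
- by have /(Ginj _ _ G1 G2)[] : y = y by [].
- by have /(Ginj _ _ G1 G2)[] : y = y by [].
- have /(Ginj _ _ G1 G2)[uu'] : y = y by [].
  by subst u'; apply: einj exu exu'.
Qed.

(** The points of [Y] and those outside it fit into two copies of [Y], and doubling does not enlarge
    [Y]. *)
Lemma card_le_half T (X Y : set T) : infinite_set [set: T] ->
  X `|` Y = [set: T] -> X #<= Y -> [set: T] #<= Y.
Proof.
move=> Tinf XY le_XY.
have Yinf : infinite_set Y.
  move=> Yfin; apply: Tinf; rewrite -XY finite_setU; split=> //.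
  exact: card_le_finite le_XY Yfin.
apply: card_le_trans (card_le_double Yinf).
have /card_le_relP[r [rex rinj]] := le_XY.
apply/card_le_relP; exists (fun x p =>
  (Y x /\ p = (x, true)) \/ [/\ ~ Y x, r x p.1 & p.2 = false]); split.
  move=> x _; have [Yx|nYx] := pselect (Y x).
    by exists (x, true) => //; left.
  have Xx : X x by have : [set: T] x by []; rewrite -XY => -[].
  by have [y Yy rxy] := rex _ Xx; exists (y, false) => //; right.
have XnY x : ~ Y x -> X x by have : [set: T] x by []; rewrite -XY => -[].
move=> x x' [y b] _ _ [[Yx [-> ->]]|[nx rx /= ->]] [[Yx' [//]]|[nx' rx' //= _]].
by apply: rinj rx rx'; exact: XnY.
Qed.

Section Small.
Variable kappa : Type.
Hypothesis nat_small : small kappa [set: nat].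

Lemma small_card_le T U (A : set T) (B : set U) :
  A #<= B -> small kappa B -> small kappa A.
Proof. by move=> AB sB kA; apply: sB; exact: card_le_trans AB. Qed.

Lemma small_countable T (A : set T) : countable A -> small kappa A.
Proof. by move=> /small_card_le; exact. Qed.

(** An injection of [kappa] into the union splits [kappa] into a part that goes into [A] and one
    that goes into [B]; the larger part has the size of [kappa]. *)
Lemma small_setU T (A B : set T) :
  small kappa A -> small kappa B -> small kappa (A `|` B).
Proof.
move=> sA sB /card_le_relP[r [rex rinj]].
pose K1 := [set k | exists2 y, A y & r k y].
have K1A : K1 #<= A.
  by apply/card_le_relP; exists r; split=> // x x' y _ _; exact: rinj.
have K2B : ~` K1 #<= B.
  apply/card_le_relP; exists r; split=> [k K1k|x x' y _ _]; last exact: rinj.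
  by have [y [Ay ry|By ry]] := rex k I; [case: K1k|]; exists y.
have kinf : infinite_set [set: kappa] by move=> /finite_set_countable.
have [le12|le21] := card_le_total K1 (~` K1).
  apply: sB; apply: card_le_trans K2B.
  by apply: card_le_half le12 => //; exact: setUv.
apply: sA; apply: card_le_trans K1A; apply: card_le_half le21 => //.
by rewrite setUC setUv.
Qed.

End Small.

(** * Realizing families from an elementary extension in a saturated model *)

Section Saturation.
Variable L : language.
Implicit Types M Q : structure L.

Definition fex X (phi : formula L (option X)) : formula L X :=
  fimp (fall (fimp phi (fbot L _))) (fbot L X).

Lemma sat_fex M X (phi : formula L (option X)) (v : X -> M) :
  sat (fex phi) v <-> exists m, sat phi (scons m v).
Proof.
split=> [/= nall|[m sm] /= /(_ m)]; last exact.
by apply: contrapT => /forallNP.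
Qed.

Lemma finite_set_conj X (s : set (formula L X)) : finite_set s ->
  exists psi : formula L X, forall M (v : X -> M),
    sat psi v <-> forall phi, s phi -> sat phi v.
Proof.
move=> /(@finite_seqP {classic formula L X})[l ->] {s}.
elim: l => [|phi l [psi psiP]].
  by exists (fimp (fbot L X) (fbot L X)) => M v; split=> // _ phi /=.
exists (fimp (fimp phi (fimp psi (fbot L X))) (fbot L X)) => M v /=.
split=> [H theta|H].
  have [sphi spsi] : sat phi v /\ sat psi v.
    by apply: contrapT => nand; apply: H => sphi spsi; apply: nand.
  by rewrite inE => /orP[/eqP ->//|]; move: theta; apply/psiP.
apply; first by apply: H; rewrite inE eqxx.
by apply/psiP => theta tl; apply: H; rewrite inE; apply/orP; right.
Qed.

Lemma total_on_bound T (F : set (set T)) n (X : 'I_n -> set T) :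
  F !=set0 -> total_on F subset -> (forall i, F (X i)) ->
  exists2 Y, F Y & forall i, X i `<=` Y.
Proof.
move=> [Z FZ] Ftot FX.
suff [Y FY XY] : exists2 Y, F Y &
    forall i, i \in fintype.enum (ordinal n) -> X i `<=` Y.
  by exists Y => // i; apply: XY; rewrite mem_enum.
elim: (fintype.enum _) => [|i s [Y FY sY]]; first by exists Z.
have [XY|YX] := Ftot _ _ (FX i) FY.
  by exists Y => // j; rewrite inE => /orP[/eqP ->//|/sY].
exists (X i) => // j; rewrite inE => /orP[/eqP ->//|/sY jY].
exact: subset_trans YX.
Qed.

(** Saturation concerns one variable; Zorn extends it to a small family. A maximal elementary
    relation that extends [h] on [D] reaches every [w i], since otherwise saturation would realize
    one more type over its small domain. *)
Lemma realize kappa M Q (h : M -> Q) I (w : I -> Q) (D : set M) :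
  small kappa [set: nat] -> saturated kappa M -> elem_rel (graph h) ->
  small kappa D -> small kappa [set: I] ->
  exists v : I -> M,
    elem_rel (fun x y => D x /\ y = h x \/ exists2 i, x = v i & y = w i).
Proof.
move=> nat_small satM hE smallD smallI.
pose R (G : set (M * Q)) x y := D x /\ y = h x \/ G (x, y).
pose P G := elem_rel (R G) /\ forall p, G p -> exists i, p.2 = w i.
have P0 : P set0.
  by split=> //; apply: sub_elem_rel hE => x y [[]|].
have [F FP Ftot|G [[GE Gw] Gmax]] := @Zorn_bigcup _ P.
  split=> [n phi v u vu|p [X FX]]; last exact: (FP _ FX).2.
  (* Adding the empty set keeps the chain nonempty, so that finitely many pairs always lie in a
     single member. *)
  pose F' := F `|` [set set0].
  have F'P X : F' X -> P X by case=> [/FP|->].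
  have F'tot : total_on F' subset.
    move=> X Y [FX|->] [FY|->]; first exact: Ftot.
    - by right.
    - by left.
    - by left.
  have /choice[X XP] i : exists X, F' X /\ R X (v i) (u i).
    have [vi|[X FX Xi]] := vu i; first by exists set0; split; [right|left].
    by exists X; split; [left|right].
  have [||i|Y F'Y XY] := @total_on_bound _ F' n X.
  - by exists set0; right.
  - exact: F'tot.
  - by have [] := XP i.
  apply: (F'P _ F'Y).1 => i.
  by have [_ [|/XY]] := XP i; [left|right].
have RI x x' y y' := @elem_rel_eq L M Q (R G) x x' y y' GE.
suff /choice[v vP] i : exists x, R G x (w i).
  exists v; apply: sub_elem_rel GE => x y [?|[i -> ->]//]; by left.
apply: contrapT => /forallNP ni.
pose dom := [set x | exists y, R G x y].
have smalldom : small kappa dom.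
  apply: (@small_card_le _ _ _ _ (D `|` [set x | exists y, G (x, y)])).
    by apply: subset_card_le => x [y [[]|]]; [left|right; exists y].
  apply: small_setU => //; apply: small_card_le smallI.
  apply/card_le_relP; exists (fun x i => G (x, w i)); split.
    by move=> x [y Gxy]; have [j /= yE] := Gw _ Gxy; exists j; rewrite -?yE.
  by move=> x x' j _ _ Gx Gx'; apply/(RI _ _ (w j) (w j)) => //; right.
have /choice[q qP] (a : dom) : exists y, R G (val a) y by have /set_mem := valP a.
(* The type of [w i], with parameters pulled back to [M]. *)
pose p := [set phi : formula_over unit dom | sat phi (sjoin (fun=> w i) q)].
have [s sfin sp|m mP] := satM dom p smalldom.
  have [psi psiP] := finite_set_conj sfin.
  pose c (z : unit + dom) := if z is inr a then Some a else None.
  have cE (N : structure L) (u : dom -> N) m : scons m u \o c = sjoin (fun=> m) u.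
    by apply/funext => -[].
  (* Finite satisfiability: [w i] realizes the conjunction in [Q], and the existential statement
     passes to [M]. *)
  have : sat (fex (fmap c psi)) q.
    apply/sat_fex; exists (w i); apply/sat_fmap; rewrite cE.
    by apply/psiP => phi /sp.
  have <- : sat (fex (fmap c psi)) (val : dom -> M) <-> sat (fex (fmap c psi)) q.
    exact: (sat_elem_rel GE).
  by move=> /sat_fex[m /sat_fmap]; rewrite cE => /psiP ?; exists m.
(* The type contains [phi] or its negation, so realizing it gives an equivalence. *)
have mE (phi : formula_over unit dom) :
    sat phi (sjoin (fun=> m) val) <-> sat phi (sjoin (fun=> w i) q).
  split=> [sm|]; last exact: mP.
  by apply: contrapT => nphi; apply: (mP (fimp phi (fbot L _))).
apply: (Gmax (G `|` [set (m, w i)])).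
  split=> [|sub]; first exact: subsetUl.
  by apply: (ni m); right; apply: sub; right.
split=> [n phi v u vu|_ [/Gw//|->]]; last by exists i.
have /choice[c cP] (k : 'I_n) : exists c : unit + dom, v k = sjoin (fun=> m) val c /\
    u k = sjoin (fun=> w i) q c.
  have [Rk|[-> ->]] : R G (v k) (u k) \/ (v k, u k) = (m, w i).
  - by have [|[]] := vu k; [left; left|left; right|right].
  - have dk : dom (v k) by exists (u k).
    exists (inr (SigSub (mem_set dk))); split=> //=.
    by apply/(RI _ _ _ _ Rk (qP _)).
  - by exists (inl tt).
have -> : v = sjoin (fun=> m) val \o c by apply/funext => k; have [] := cP k.
have -> : u = sjoin (fun=> w i) q \o c by apply/funext => k; have [] := cP k.
by have := mE (fmap c phi); rewrite !sat_fmap.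
Qed.

End Saturation.

(** * Copies of a structure glued over a closed subset *)

Section Copies.
Variables (L : language) (M : structure L) (S : set M).
Hypothesis S_closed : hull S `<=` S.
Variable K : Type.

(** The tag [None] marks the points shared by all copies. *)
Definition copy_tag (k : K) (x : M) : M * option K :=
  (x, if pselect (S x) then None else Some k).

Lemma copy_tagE k l x y :
  copy_tag k x = copy_tag l y <-> x = y /\ (k = l \/ S x).
Proof.
rewrite /copy_tag; split=> [[<-]|[<- [<-//|Sx]]]; case: pselect => //=.
  by split=> //; right.
by move=> _ [<-]; split=> //; left.
Qed.

Lemma copy_tag_inj k : injective (copy_tag k).
Proof. by move=> x y /copy_tagE[]. Qed.

Lemma copy_tag_tuple k l n (x y : 'I_n -> M) :
  (forall i, copy_tag k (x i) = copy_tag l (y i)) ->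
  x = y /\ (k = l \/ forall i, S (x i)).
Proof.
move=> xy; split; first by apply/funext => i; have /copy_tagE[] := xy i.
have [->|kl] := pselect (k = l); [by left|right=> i].
by have /copy_tagE[_ []] := xy i.
Qed.

Lemma copy_tag_fun k l (f : Defs.fsym L) x y :
  (forall i, copy_tag k (x i) = copy_tag l (y i)) ->
  copy_tag k (finterp M f x) = copy_tag l (finterp M f y).
Proof.
move=> /copy_tag_tuple[<- [<-//|Sx]]; apply/copy_tagE; split=> //; right.
by apply: S_closed; apply: hull_app => i; apply: hull_base.
Qed.

Lemma copy_tag_rel k l (R : rsym L) x y :
  (forall i, copy_tag k (x i) = copy_tag l (y i)) ->
  rinterp M R x -> rinterp M R y.
Proof. by move=> /copy_tag_tuple[<-]. Qed.

Definition copies : structure L := glue copy_tag.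
Definition copy (k : K) : M -> copies := @glue_in _ _ _ _ copy_tag k.

Lemma embedding_copy k : embedding (copy k).
Proof. exact: (embedding_glue_in copy_tag_inj copy_tag_fun copy_tag_rel). Qed.

Lemma copyE k l x y : copy k x = copy l y <-> x = y /\ (k = l \/ S x).
Proof. by rewrite -copy_tagE /copy /glue_in /=; split=> [/Some_inj|->]. Qed.

(** A function whose arguments lie in no single copy takes the value [None], so closed parts that
    agree on [S] generate nothing new inside the copies. *)
Lemma copies_hull (Z : K -> set M) l x :
  (forall k, hull (Z k) `<=` Z k) ->
  (forall k k', Z k `&` S `<=` Z k') ->
  hull (\bigcup_k (copy k @` Z k)) (copy l x) -> Z l x.
Proof.
move=> Z_closed ZS; set A := (X in hull X).
have ZE k y : A (copy k y) -> Z k y.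
  case=> k' _ [y' Zy' /copyE[<- [<-//|Sy]]].
  exact: (ZS k' k).
suff H u : hull A u -> u = None \/ A u by case/H => // /ZE.
elim=> [{}u|f a _ IH]; first by right.
have [[k [y aE]]|] := glue_fun a; last by left.
right; exists k => //; exists (finterp M f y); last first.
  by rewrite (embedding_fun (embedding_copy k)) aE.
apply: Z_closed; apply: hull_app => i; apply: hull_base; apply: ZE.
by have := IH i; rewrite aE /= => -[].
Qed.

Section Shift.
Variable I : Type.

(** Moving copies around in this way will show that they are indiscernible over [S]. *)
Definition shift (s t : I -> K) (u u' : copies) : Prop :=
  u = None /\ u' = None \/
  exists i x, u = copy (s i) x /\ u' = copy (t i) x.

Lemma shiftC s t u u' : shift s t u u' -> shift t s u' u.
Proof.
by case=> [[-> ->]|[i [x [-> ->]]]]; [left|right; exists i, x].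
Qed.

(** If [k] is no value of [s], the tuple lies in [S], which all copies share, and any index will do;
    this is where an element of [I] comes in. *)
Lemma shift_copy s t k n (x : 'I_n -> M) (u : 'I_n -> copies) : I ->
  injective s -> (forall j, shift s t (copy k (x j)) (u j)) ->
  exists i, copy k \o x = copy (s i) \o x /\ u = copy (t i) \o x.
Proof.
move=> i0 s_inj xu.
have [[i siE]|nk] := pselect (exists i, s i = k).
  exists i; rewrite siE; split=> //; apply/funext => j.
  have [[]//|[i' [y [/copyE[xy kS] ->]]]] := xu j.
  apply/copyE; rewrite xy; split=> //.
  case: kS => [|Sx]; last by right; rewrite -xy.
  by rewrite -siE => /s_inj <-; left.
exists i0; split; apply/funext => j;
  have [[]//|[i' [y [/copyE[xy [ki'|Sx]] uE]]]] := xu j.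
- by case: nk; exists i'.
- by apply/copyE; split=> //; right.
- by case: nk; exists i'.
- by rewrite uE; apply/copyE; rewrite -xy; split=> //; right.
Qed.

Lemma partial_iso_shift s t : I -> injective s -> injective t ->
  partial_iso (shift s t).
Proof.
move=> i0 s_inj t_inj.
have eqS (s' t' : I -> K) : injective s' -> forall u v u' v',
    shift s' t' u u' -> shift s' t' v v' -> u = v -> u' = v'.
  move=> s'_inj u v u' v' [[-> ->]|[i [x [-> ->]]]] [[-> ->]|[j [y [-> ->]]]] //.
  by move=> /copyE[-> [/s'_inj -> //|Sx]]; apply/copyE; split=> //; right.
have pieceS (s' t' : I -> K) : injective s' -> forall n (u u' : 'I_n -> copies),
    (forall j, shift s' t' (u j) (u' j)) -> forall k x, u = copy k \o x ->
    exists i, u = copy (s' i) \o x /\ u' = copy (t' i) \o x.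
  move=> s'_inj n u u' uu' k x uE.
  have [|i [xE u'E]] := @shift_copy s' t' k n x u' i0 s'_inj.
    by move=> j; have := uu' j; rewrite uE.
  by exists i; rewrite -xE -uE.
have copy_fun i f (x : 'I_(farity f) -> M) :
    finterp copies f (copy i \o x) = copy i (finterp M f x).
  by rewrite (embedding_fun (embedding_copy i)).
split.
- move=> u v u' v' uu' vv'; split; first exact: eqS uu' vv'.
  exact: (eqS t s) (shiftC uu') (shiftC vv').
- move=> f a b ab; have ba j := shiftC (ab j).
  have [[k [x aE]]|fa] := glue_fun a.
    have [i [-> ->]] := pieceS _ _ s_inj _ _ _ ab _ _ aE.
    by right; exists i, (finterp M f x); rewrite !copy_fun.
  (* If both values are [None], [shift] relates them; otherwise [b] lies in one copy, and so does
     [a]. *)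
  have [[k [x bE]]|fb] := glue_fun b; last by left.
  have [i [-> ->]] := pieceS _ _ t_inj _ _ _ ba _ _ bE.
  by right; exists i, (finterp M f x); rewrite !copy_fun.
- move=> R a b ab; have ba j := shiftC (ab j).
  split=> -[k [x [xE Rx]]].
    have [i [_ ->]] := pieceS _ _ s_inj _ _ _ ab _ _ xE.
    by exists (t i), x.
  have [i [_ ->]] := pieceS _ _ t_inj _ _ _ ba _ _ xE.
  by exists (s i), x.
Qed.

End Shift.
End Copies.

(** * Copies inside a model of the companion *)

Section CopiesCompanion.
Variables (L : language) (T : theory L) (hT : model_companion T set0).
Implicit Types M N Q : structure L.

Lemma partial_iso_embedding M N Q Q' (r : M -> N -> Prop) (e : M -> Q)
  (e' : N -> Q') : embedding e -> embedding e' -> partial_iso r ->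
  partial_iso (fun u v => exists x y, [/\ r x y, u = e x & v = e' y]).
Proof.
move=> [e_inj e_fun e_rel] [e'_inj e'_fun e'_rel] [r_eq r_fun r_rel].
have lift n (a : 'I_n -> Q) (b : 'I_n -> Q') :
    (forall i, exists x y, [/\ r x y, a i = e x & b i = e' y]) ->
    exists c d, [/\ forall i, r (c i) (d i), a = e \o c & b = e' \o d].
  move=> /choice[c /choice[d cdP]]; exists c, d.
  by split=> [i||]; [|apply/funext => i..]; have [] := cdP i.
split.
- move=> u u' v v' [x [y [xy -> ->]]] [x' [y' [xy' -> ->]]].
  split=> [/e_inj xx'|/e'_inj yy'].
    by congr e'; apply/(r_eq _ _ _ _ xy xy').
  by congr e; apply/(r_eq _ _ _ _ xy xy').
- move=> f a b /lift[c [d [cd -> ->]]].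
  by exists (finterp M f c), (finterp N f d); split=> //; exact: r_fun.
- move=> R a b /lift[c [d [cd -> ->]]].
  by rewrite -e_rel -e'_rel; exact: r_rel.
Qed.

Lemma embedding_hull M N (e : M -> N) (A : set M) u :
  embedding e -> hull (e @` A) u -> exists2 x, u = e x & hull A x.
Proof.
move=> eE; elim=> [_ [x Ax <-]|f a _ IH]; first by exists x => //; exact: hull_base.
have /choice[c cP] i : exists x, a i = e x /\ hull A x by have [x] := IH i; exists x.
exists (finterp M f c); last by apply: hull_app => i; have [] := cP i.
by rewrite (embedding_fun eE); congr finterp; apply/funext => i; have [] := cP i.
Qed.

(** The clause on [Z] controls generated substructures across copies. The last clause gives
    indiscernibility over [S], whose points are fixed because all copies share them. *)
Lemma copies_companion M (S : set M) (K : Type) :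
  models T M -> hull S `<=` S ->
  exists (Q : structure L) (h : K -> M -> Q),
    [/\ models T Q, forall k, embedding (h k),
        forall k l x y, h k x = h l y <-> x = y /\ (k = l \/ S x),
        forall Z : K -> set M, (forall k, hull (Z k) `<=` Z k) ->
          (forall k l, Z k `&` S `<=` Z l) ->
          forall l x, hull (\bigcup_k (h k @` Z k)) (h l x) -> Z l x
      & forall I (s t : I -> K), I -> injective s -> injective t ->
          elem_rel (fun u v => exists i x, u = h (s i) x /\ v = h (t i) x)].
Proof.
move=> TM S_closed.
have [Q TQ [e eE]] := embeds_in_companion hT (copies S K).
exists Q, (fun k => e \o copy S k); split=> //.
- by move=> k; apply: embedding_comp => //; exact: embedding_copy.
- move=> k l x y /=; rewrite -copyE.
  by split=> [/(embedding_inj eE)//|->].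
- move=> Z Z_closed ZS l x.
  have -> : \bigcup_k ((e \o copy S k) @` Z k) =
      e @` \bigcup_k (copy S k @` Z k).
    apply/seteqP; split=> [_ [k _ [y Zy <-]]|_ [_ [k _ [y Zy <-]] <-]].
      by exists (copy S k y) => //; exists k => //; exists y.
    by exists k => //; exists y.
  move=> /(embedding_hull eE)[u /(embedding_inj eE) <-].
  exact: copies_hull.
- move=> I s t i0 s_inj t_inj.
  have := partial_iso_shift S_closed i0 s_inj t_inj.
  move=> /(partial_iso_embedding eE eE) /(partial_iso_elem_rel hT TQ TQ).
  apply: sub_elem_rel => _ _ [i [x [-> ->]]].
  exists (copy S (s i) x), (copy S (t i) x); split=> //.
  by right; exists i, x.
Qed.

End CopiesCompanion.

Lemma tp_satP (L : language) (M : structure L) X (e e' : X -> M) (D : set M) :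
  tp e D = tp e' D <-> forall phi : formula L (X + D),
    sat phi (sjoin e val) <-> sat phi (sjoin e' val).
Proof.
split=> [ee' phi|ee']; last by apply/seteqP; split=> phi; move/(ee' phi).
suff -> : sat phi (sjoin e val) = sat phi (sjoin e' val) by [].
exact: (congr1 (@^~ phi) ee').
Qed.

(** * Algebraic closure and M-dividing independence in the monster model *)

Section Monster.
Variables (L : language) (T : theory L) (hT : model_companion T set0).
Variables (kappa : Type) (M : structure L).
Hypothesis TM : models T M.
Hypothesis nat_small : small kappa [set: nat].
Hypothesis satM : saturated kappa M.
Implicit Types A B C D : set M.

Lemma aclE A : acl A = hull A.
Proof.
apply/seteqP; split=> m; last first.
  move=> /hull_term[t ->].
  exists (feq (tvar L (inl tt)) (tmap inr t)).
  rewrite /holds /= teval_tmap; split=> //.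
  apply: (@sub_finite_set _ _ [set teval val t]); last exact: finite_set1.
  by move=> x; rewrite /= teval_tmap.
move=> [phi [phim phifin]]; apply: contrapT => nAm.
(* The images of [m] in infinitely many copies over [hull A] are distinct and all satisfy [phi];
   they are then pulled back to [M]. *)
have [Q [h [TQ hE h_eq _ _]]] :=
  copies_companion hT nat TM (@hull_closed _ _ A).
have [n [c [e ecK]]] := finite_set_code (finite_fvars phi).
(* [A] may fail to be small, so only finitely many values, among them those of the variables of
   [phi], are kept as parameters. *)
pose D := range (sjoin (fun=> m) val \o e : 'I_n -> M).
have [|||v vE] := @realize _ kappa M Q (h 0) nat (h^~ m) D nat_small satM.
- exact: (embedding_elementary hT TM TQ (hE 0)).
- apply: small_countable => //; apply: finite_set_countable.
  by apply: finite_image; exact: finite_finset.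
- exact: nat_small.
have v_inj : injective v.
  move=> k l; have -> : v k = v l <-> h k m = h l m.
    by apply: (elem_rel_eq vE); right; [exists k|exists l].
  by move=> /h_eq[_ []].
suff phiv k : holds phi (fun=> v k).
  move/finite_setPn: phifin; apply; apply/card_le_relP; exists (fun k x => x = v k).
  by split=> [k _|k l x _ _ -> /v_inj//]; exists (v k) => //; exact: phiv.
have -> : holds phi (fun=> v k) <->
    sat phi (sjoin (fun=> v k) val \o (e \o c)).
  by apply: sat_ext => x /ecK /= ->.
have -> : sat phi (sjoin (fun=> v k) val \o (e \o c)) <->
    sat phi (sjoin (fun=> h k m) (h 0 \o val) \o (e \o c)).
  apply: (sat_elem_rel vE) => x /=; case E : (e (c x)) => [[]|a] /=.
    by right; exists k.
  by left; split=> //; exists (c x) => //=; rewrite E.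
have -> : sat phi (sjoin (fun=> h k m) (h 0 \o val) \o (e \o c)) <->
    sat phi (sjoin (fun=> h k m) (h 0 \o val)).
  by apply: sat_ext => x /ecK /= ->.
have <- // : sat phi (sjoin (fun=> m) val) <->
    sat phi (sjoin (fun=> h k m) (h 0 \o val)).
apply: (sat_elem_rel (embedding_elementary hT TM TQ (hE k))) => -[x|a] //=.
by apply/h_eq; split=> //; right; apply: hull_base; exact/set_mem/valP.
Qed.

(** As [C'] lies in the closure of [B] and [C], adjoining it to [B] generates that same closure, and
    one inclusion of the independence is automatic. *)
Lemma indep_MP C A B : indep_M C A B <->
  forall C', C `<=` C' -> C' `<=` hull (B `|` C) ->
    hull (A `|` C') `&` hull (B `|` C) `<=` hull C'.
Proof.
have BCE C' : C `<=` C' -> C' `<=` hull (B `|` C) ->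
    hull (B `|` C') = hull (B `|` C).
  move=> CC' C'BC; apply/seteqP; split.
    by apply: hull_sub => x [Bx|/C'BC//]; apply: hull_base; left.
  by apply: hullS => x [|/CC']; [left|right].
split=> H C' CC' C'BC.
  by have := H C' CC'; rewrite /indep_a !aclE BCE// => /(_ C'BC) ->.
rewrite aclE in C'BC; rewrite /indep_a !aclE BCE//; apply/seteqP; split.
  exact: H.
move=> x C'x; split; first by apply: hullS C'x => y; right.
by apply: hull_sub C'x.
Qed.

(** * Dividing independence against M-dividing independence *)

Lemma indep_d_M A B C : small kappa B -> small kappa C ->
  indep_d C A B -> indep_M C A B.
Proof.
move=> smallB smallC dAB; apply/indep_MP => C' CC' C'BC x [ACx BCx].
apply: contrapT => nC'x.
pose BC := B `|` C.
have [Q [h [TQ hE h_eq _ h_shift]]] :=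
  copies_companion hT nat TM (@hull_closed _ _ C').
have hC' i j y : hull C' y -> h i y = h j y.
  by move=> C'y; apply/h_eq; split=> //; right.
(* [t] expresses [x] through [A] and terms over [BC] with values in [C'], so its
   value does not change when [BC] moves while those terms are fixed. *)
have [t [tx t_eq]] : exists t : term L (A + BC), x = teval (sjoin val val) t /\
    forall (N : structure L) (al : A -> N) (be be' : BC -> N),
      (forall s : term L BC, C' (teval val s) -> teval be s = teval be' s) ->
      teval (sjoin al be) t = teval (sjoin al be') t.
  elim: ACx => [y [Ay|C'y]|f c _ IH].
  - by exists (tvar L (inl (SigSub (mem_set Ay)))).
  - have [s yE] := hull_term (C'BC _ C'y).
    exists (tmap inr s); rewrite teval_tmap; split=> // N al be be' H.
    by rewrite !teval_tmap; apply: H; rewrite -yE.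
  - have [ts tsP] := choice IH; exists (tapp ts) => /=; split.
      by congr finterp; apply/funext => i; have [] := tsP i.
    move=> N al be be' H; congr finterp; apply/funext => i.
    by have [_ +] := tsP i; apply.
have [u ux] := hull_term BCx.
(* Equates two terms for [x]: [t] over [A] and [BC], and [u] over [BC] alone. *)
pose phi : formula L (A + BC) := feq t (tmap inr u).
have finl : finite_set (inl @^-1` fvars phi : set A).
  by apply: finite_preimage (finite_fvars phi) => ? ? _ _ [].
have finr : finite_set (inr @^-1` fvars phi : set BC).
  by apply: finite_preimage (finite_fvars phi) => ? ? _ _ [].
have [n [cA [eA eAK]]] := finite_set_code finl.
have [m [cB [eB eBK]]] := finite_set_code finr.
pose c (z : A + BC) : 'I_n + 'I_m :=
  match z with inl a => inl (cA a) | inr b => inr (cB b) end.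
have satc (N : structure L) (al : 'I_n -> N) (be : 'I_m -> N) (be' : BC -> N) :
    (forall z, be z = be' (eB z)) ->
    sat (fmap c phi) (sjoin al be) <-> sat phi (sjoin (al \o cA) be').
  move=> beE; rewrite sat_fmap; apply: sat_ext => -[z _ //|z] /=.
  by rewrite inE => zphi; rewrite beE eBK ?inE.
pose b (j : 'I_m) : M := val (eB j).
have bBC j : BC (b j) by exact/set_mem/valP.
apply: (dAB n m (fmap c phi) (val \o eA) b).
- by move=> i; exact/set_mem/valP.
- exact: bBC.
- apply/satc => //; rewrite /phi /=.
  have -> : teval (sjoin ((val \o eA) \o cA) val) t = teval (sjoin val val) t.
    apply: teval_ext => -[z|//]; rewrite inE => tz /=.
    by rewrite eAK// inE; left.
  by rewrite teval_tmap -tx {1}ux.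
(* The copies of [b] are pulled back to [M] with [BC] fixed through copy [0], so that the sequence
   starts with [b] itself. *)
have [|||v vE] := @realize _ kappa M Q (h 0) (nat * 'I_m)%type
  (fun p => h p.1 (b p.2)) BC nat_small satM.
- exact: (embedding_elementary hT TM TQ (hE 0)).
- exact: small_setU.
- by apply: small_countable => //; exact: countableP.
have vI := partial_iso_gen vE.
exists (fun i j => v (i, j)); split.
- move=> k s s' s_incr s'_incr.
  (* The empty tuple is treated apart, since [h_shift] requires an index. *)
  case: k s s' s_incr s'_incr => [|k] s s' s_incr s'_incr.
    by congr (tp _ C); apply/funext => -[[]].
  have incr_inj (f : 'I_k.+1 -> nat) : increasing f -> injective f.
    move=> f_incr i j fij; apply: val_inj => /=.
    by case: (ltngtP i j) => // /f_incr; rewrite fij ltnn.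
  apply/tp_satP => psi.
  have vh (f : 'I_k.+1 -> nat) :
      sat psi (sjoin (fun p => v (f p.1, p.2)) val) <->
      sat psi (sjoin (fun p => h (f p.1) (b p.2)) (h 0 \o val)).
    apply: (sat_elem_rel vE) => -[p|d] /=.
      by right; exists (f p.1, p.2).
    by left; split=> //; right; exact/set_mem/valP.
  rewrite !vh.
  have hs := h_shift _ _ _ ord0 (incr_inj _ s_incr) (incr_inj _ s'_incr).
  apply: (sat_elem_rel hs) => -[p|d] /=.
    by exists p.1, (b p.2).
  have C'd : hull C' (val d) by apply/hull_base/CC'; exact/set_mem/valP.
  by exists ord0, (val d); split; apply: hC'.
- apply/funext => j.
  have -> // : v (0, j) = b j <-> h 0 (b j) = h 0 (b j).
  by apply: (elem_rel_eq vE); [right; exists (0, j)|left].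
- move=> [a aP].
  (* A common realization in [M] and the copies in [Q] are compared in an amalgam. There [t] equals
     the image of [x] in every copy, yet its value does not depend on the copy. *)
  have [N [f [g [TN fE gE fg]]]] := amalgam_companion hT vI.
  pose al (z : A) := f (a (cA z)).
  pose be k (z : BC) := g (h k (val z)).
  have gh_teval k (s : term L BC) : teval (be k) s = g (h k (teval val s)).
    by rewrite -(embedding_teval (hE k)) -(embedding_teval gE).
  have betE k : teval (sjoin al (be k)) t = g (h k x).
    have : sat (fmap c phi) (sjoin (f \o a) (fun j => f (v (k, j)))).
      have <- : sat (fmap c phi) (sjoin a (fun j => v (k, j))) <->
          sat (fmap c phi) (sjoin (f \o a) (fun j => f (v (k, j)))).
        by apply: (sat_elem_rel (embedding_elementary hT TM TN fE)) => -[].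
      exact: aP.
    rewrite (satc _ _ _ (be k)) /phi /=.
      by rewrite teval_tmap => ->; rewrite gh_teval -ux.
    by move=> z; apply: fg; apply: gen_base; right; exists (k, z).
  have : g (h 0 x) = g (h 1 x).
    rewrite -!betE; apply: t_eq => s C's; rewrite !gh_teval.
    by rewrite (hC' 0 1)//; exact: hull_base.
  by move=> /(embedding_inj gE) /h_eq[_ []].
Qed.

Lemma indep_M_d A B C : indep_M C A B -> indep_d C A B.
Proof.
move=> /indep_MP MAB n m phi a b Aa BCb satab [bs [bs_ind bs0 []]].
have increasing2 i j : i < j ->
    increasing (fun o : 'I_2 => if o == ord0 then i else j).
  by move=> ij [[|[|//]] ?] [[|[|//]] ?].
(* An equality between a term at [i] and a term at [j] is a formula on a pair, so indiscernibility
   moves it to any other increasing pair. *)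
have shift2 (t s : term L 'I_m) i j k l : i < j -> k < l ->
    teval (bs i) t = teval (bs j) s -> teval (bs k) t = teval (bs l) s.
  move=> ij kl.
  have /tp_satP := bs_ind 2 _ _ (increasing2 _ _ ij) (increasing2 _ _ kl).
  pose var o (z : 'I_m) : 'I_2 * 'I_m + C := inl (o, z).
  move=> /(_ (feq (tmap (var ord0) t) (tmap (var (inord 1)) s))) /=.
  have i1 : (inord 1 == ord0 :> 'I_2) = false by rewrite -val_eqE /= inordK.
  rewrite !teval_tmap /comp /= i1.
  by case.
pose r i (x y : M) := (exists2 z, x = b z & y = bs i z) \/ C x /\ y = x.
have rE i : elem_rel (r i).
  move=> k psi v w vw.
  have incr1 j : increasing (fun _ : 'I_1 => j) by move=> x y; rewrite !ord1.
  have /tp_satP ind1 := bs_ind 1 _ _ (incr1 0) (incr1 i).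
  have /choice[c cP] (z : 'I_k) : exists c : 'I_1 * 'I_m + C,
      v z = sjoin (fun p => bs 0 p.2) val c /\ w z = sjoin (fun p => bs i p.2) val c.
    have [[x -> ->]|[Cx ->]] := vw z.
      by exists (inl (ord0, x)); rewrite /= bs0.
    by exists (inr (SigSub (mem_set Cx))).
  have -> : v = sjoin (fun p => bs 0 p.2) val \o c.
    by apply/funext => z; have [] := cP z.
  have -> : w = sjoin (fun p => bs i p.2) val \o c.
    by apply/funext => z; have [] := cP z.
  by have := ind1 (fmap c psi); rewrite !sat_fmap.
(* The isomorphism from [<b>] to [<bs i>], without the parameters [C]. *)
pose rho i x y := exists t : term L 'I_m, x = teval b t /\ y = teval (bs i) t.
have rho_gen i x y : rho i x y -> gen (r i) x y.
  by move=> /gen_termP; apply: gen_sub => ? ? ?; left.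
have rho_eq i x x' y y' : rho i x y -> rho i x' y' -> x = x' <-> y = y'.
  move=> /rho_gen xy /rho_gen x'y'.
  exact: (partial_iso_eq (partial_iso_gen (rE i))).
have rho_fun i (f : Defs.fsym L) x y : (forall o, rho i (x o) (y o)) ->
    rho i (finterp M f x) (finterp M f y).
  move=> /choice[ts tsP]; exists (tapp ts).
  by split; congr finterp; apply/funext => o; have [] := tsP o.
have rho_rel i (R : rsym L) x y : (forall o, rho i (x o) (y o)) ->
    rinterp M R x <-> rinterp M R y.
  move=> xy; apply: (partial_iso_rel (partial_iso_gen (rE i))) => o.
  exact: rho_gen.
pose hb x := exists t : term L 'I_m, x = teval b t.
pose E := [set x | forall i, rho i x x].
pose W := hull (range a `|` E).
have WE x : W x -> hb x -> E x.
  move=> Wx [t xt] i.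
  have Ehull : C `|` E `<=` hull (B `|` C).
    move=> y [Cy|/(_ 0)[s [-> _]]]; first by apply: hull_base; right.
    exact: hull_teval.
  have CEx : hull (C `|` E) x.
    apply: (MAB _ _ Ehull); first by left.
    split; last by rewrite xt; exact: hull_teval.
    by apply: hullS Wx => y [[z _ <-]|Ey]; [left|right; right].
  (* Elements generated by [C] and [E] are fixed by the isomorphism that extends [r i], so the value
     of [t] at [bs i] is again [x]. *)
  have xx : gen (r i) x x.
    elim: CEx => [y [Cy|Ey]|f c _ IH]; [|exact: rho_gen|exact: gen_app].
    by apply: gen_base; right.
  exists t; split=> //.
  have xy : rho i x (teval (bs i) t) by exists t.
  exact/(partial_iso_eq (partial_iso_gen (rE i)) xx (rho_gen _ _ _ xy)).
(* If [t] at [i] equals [s] at [j], the same holds at all increasing pairs; comparing through a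
   third index shows that both terms are constant along the sequence, with one value. *)
have rho_lt i j x y z : i < j -> rho i x z -> rho j y z -> x = y /\ E x.
  move=> ij [t [-> ->]] [s [-> ts]].
  have ts_lt k l : k < l -> teval (bs k) t = teval (bs l) s.
    by move=> kl; exact: shift2 ij kl ts.
  have tt_lt k l : k < l -> teval (bs k) t = teval (bs l) t.
    by move=> kl; apply: (shift2 t t 0 1) => //; rewrite (ts_lt 0 2)// (ts_lt 1 2).
  have ss_lt k l : k < l -> teval (bs k) s = teval (bs l) s.
    by move=> kl; apply: (shift2 s s 1 2) => //; rewrite -(ts_lt 0 2)// -(ts_lt 0 1).
  have tE k : teval (bs k) t = teval b t.
    by rewrite -bs0; case: k => // k; rewrite -(tt_lt 0 k.+1).
  split; last by move=> k; exists t.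
  by rewrite -(tE 0) (ts_lt 0 1)// -(ss_lt 0 1)// bs0.
have rho_neq i j x y z : i <> j -> rho i x z -> rho j y z -> x = y /\ E x.
  move=> /eqP; rewrite neq_ltn => /orP[ij|ji] xz yz; first exact: rho_lt xz yz.
  by have [-> Ex] := rho_lt _ _ _ _ _ ji yz xz.
(* Copy [i] of [M] is glued to the copy [None] along [b -> bs i], and all the
   numbered copies are glued together along [W]. *)
pose g (k : option nat) (x : M) : M * option (option nat) :=
  if k is Some i then
    if pselect (exists y, rho i x y) is left e then (projT1 (cid e), None)
    else (x, Some (if pselect (W x) then None else Some i))
  else (x, None).
have gE i x y : rho i x y -> g (Some i) x = (y, None).
  rewrite /g => xy; case: pselect => [e|[]]; last by exists y.
  by case: cid => y' xy' /=; congr (_, _); apply/(rho_eq _ _ _ _ _ xy' xy).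
have gI i x y : g (Some i) x = (y, None) -> rho i x y.
  by rewrite /g; case: pselect => //= e; case: cid => y' /= xy' [<-].
have gJ i x z o : g (Some i) x = (z, Some o) ->
    z = x /\ (W x /\ o = None \/ ~ W x /\ o = Some i).
  rewrite /g; case: pselect => // _; case: pselect => Wx [<- <-]; split=> //.
    by left.
  by right.
(* Points of [W] in [<b>] lie in [E] and are sent to themselves in the copy [None]; the other points
   of [W] carry the tag [Some None]. *)
have gW i j x : W x -> g (Some i) x = g (Some j) x.
  move=> Wx; have [xb|nxb] := pselect (hb x).
    by have Ex := WE _ Wx xb; rewrite (gE _ _ _ (Ex i)) (gE _ _ _ (Ex j)).
  have nrho k : ~ exists y, rho k x y by case=> y [t [xt _]]; apply: nxb; exists t.
  rewrite /g; case: pselect => [ei|_]; first by case: (nrho _ ei).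
  case: (pselect (exists y, rho j x y)) => [ej|_]; first by case: (nrho _ ej).
  by case: pselect.
have g_inj k : injective (g k).
  case: k => [i|] x y; last by case.
  case gx: (g (Some i) x) => [z [o|]] /esym gy; last first.
    exact/(rho_eq _ _ _ _ _ (gI _ _ _ gx) (gI _ _ _ gy)).
  by have [<- _] := gJ _ _ _ _ gx; have [<- _] := gJ _ _ _ _ gy.
have g_neq i j x y : i <> j -> g (Some i) x = g (Some j) y -> x = y /\ W x.
  move=> ij; case gx: (g (Some i) x) => [z [o|]] /esym gy; last first.
    have [-> Ey] := rho_neq _ _ _ _ _ ij (gI _ _ _ gx) (gI _ _ _ gy).
    by split=> //; apply: hull_base; right.
  have [zx [[Wx _]|[_ oi]]] := gJ _ _ _ _ gx; have [zy oy] := gJ _ _ _ _ gy.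
    by split=> //; rewrite -zx -zy.
  by case: oy => -[_]; rewrite oi // => -[].
(* Tuples from two pieces coincide only within one piece, inside [W], or along some [rho i]. *)
have g_cases k l p (x y : 'I_p -> M) : (forall o, g k (x o) = g l (y o)) ->
    [\/ k = l /\ x = y,
        x = y /\ (exists i j, [/\ k = Some i, l = Some j & forall o, W (x o)]),
        exists i, [/\ k = Some i, l = None & forall o, rho i (x o) (y o)]
      | exists i, [/\ k = None, l = Some i & forall o, rho i (y o) (x o)]].
  move=> xy; have [kl|kl] := pselect (k = l).
    apply: Or41; split=> //; apply/funext => o.
    by apply: (g_inj k); rewrite {2}kl.
  case: k l xy kl => [i|] [j|] xy kl //.
  - have ij : i <> j by move=> ij; apply: kl; rewrite ij.
    apply: Or42; split; first by apply/funext => o; have [] := g_neq _ _ _ _ ij (xy o).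
    by exists i, j; split=> // o; have [] := g_neq _ _ _ _ ij (xy o).
  - by apply: Or43; exists i; split=> // o; apply: gI; rewrite xy.
  - by apply: Or44; exists j; split=> // o; apply: gI; rewrite -xy.
have g_fun k l (f : Defs.fsym L) x y : (forall o, g k (x o) = g l (y o)) ->
    g k (finterp M f x) = g l (finterp M f y).
  move=> /g_cases[[-> ->]//|[-> [i [j [-> -> Wx]]]]|[i [-> -> xy]]|[i [-> -> xy]]].
  - by apply: gW; exact: hull_app.
  - by apply: gE; exact: rho_fun.
  - by apply/esym/gE; exact: rho_fun.
have g_rel k l (R : rsym L) x y : (forall o, g k (x o) = g l (y o)) ->
    rinterp M R x -> rinterp M R y.
  move=> /g_cases[[_ ->]//|[-> //]|[i [_ _ /rho_rel ->//]]|[i [_ _ /rho_rel ->//]]].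
have [Q TQ [e eE]] := embeds_in_companion hT (@glue L _ _ (fun=> M) g).
pose h k : M -> Q := e \o @glue_in L _ _ (fun=> M) g k.
have hE k : elem_rel (graph (h k)).
  apply: (embedding_elementary hT TM TQ); apply: embedding_comp eE.
  exact: embedding_glue_in.
have h_eq k l x y : g k x = g l y -> h k x = h l y by rewrite /h /glue_in /= => ->.
pose D := [set bs p.1 p.2 | p in [set: nat * 'I_m]].
(* The numbered copies agree on [a], which lies in [W]; copy [0] stands for all of them. *)
have [||v vE] := @realize _ kappa M Q (h None) 'I_n (h (Some 0) \o a) D
  nat_small satM (hE None).
- apply: small_countable => //; apply: card_le_trans (card_image_le _ _) _.
  exact: countableP.
- by apply: small_countable => //; exact: countableP.
exists v => i.
have -> : sat phi (sjoin v (bs i)) <->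
    sat phi (sjoin (h (Some 0) \o a) (h None \o bs i)).
  apply: (sat_elem_rel vE) => -[z|z] /=; first by right; exists z.
  by left; split=> //; exists (i, z).
(* Copy [i] carries [b] to [bs i] and [a] to the common tuple, hence transports the truth of
   [phi]. *)
have <- // : sat phi (sjoin a b) <->
    sat phi (sjoin (h (Some 0) \o a) (h None \o bs i)).
apply: (sat_elem_rel (hE (Some i))) => -[z|z] /=; apply: h_eq.
  by apply: gW; apply: hull_base; left; exists z.
by apply/esym/gE; exists (tvar L z).
Qed.

(** * Extension over arbitrary sets *)

Lemma extension_indep_M : extension kappa (@indep_M L M).
Proof.
move=> A B C B' smallA smallB smallC smallB' /indep_MP MAB.
pose S := hull (B `|` C).
have S_closed : hull S `<=` S by exact: hull_sub.
have [Q [h [TQ hE h_eq h_hull _]]] := copies_companion hT bool TM S_closed.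
have hS k l x : S x -> h k x = h l x.
  by move=> Sx; apply/h_eq; split=> //; right.
pose D := (B `|` B') `|` C.
(* Copy [true] carries [D] and copy [false] carries [A]; realizing the latter over [D] gives the new
   set. *)
have [|||v vE] :=
  @realize _ kappa M Q (h true) A (h false \o val) D nat_small satM.
- exact: (embedding_elementary hT TM TQ (hE true)).
- by apply: small_setU => //; exact: small_setU.
- apply: small_card_le smallA.
  by move: (card_setT A); rewrite card_eq_le => /andP[].
exists (range v); split.
  exists A, val, v; split=> //.
    apply/seteqP; split=> [_ [x _ <-]|x Ax]; first exact/set_mem/valP.
    by exists (SigSub (mem_set Ax)).
  apply/tp_satP => phi.
  have -> : sat phi (sjoin v val) <-> sat phi (sjoin (h false \o val) (h true \o val)).
    apply: (sat_elem_rel vE) => -[x|x] /=; first by right; exists x.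
    left; split=> //; have /set_mem := valP x.
    by case=> ?; [left; left|right].
  apply: (sat_elem_rel (embedding_elementary hT TM TQ (hE false))) => -[x|x] //=.
  by apply: hS; apply: hull_base; exact/set_mem/valP.
apply/indep_MP => C' CC' C'D x [AC'x Dx].
(* The contributions of the two copies to the closure of the new set and [C']. Inside [S] that of
   [false] must not exceed [hull C'], which is the independence of [A] at the base formed by the
   points of [S] in [hull C']. *)
pose Z (k : bool) := if k then hull C' else hull (A `|` (hull C' `&` S)).
pose r x y := D x /\ y = h true x \/ exists2 i, x = v i & y = (h false \o val) i.
have rE : elem_rel r := vE.
have genD y : hull D y -> gen r y (h true y).
  elim=> [{}y Dy|f c _ IH]; first by apply: gen_base; left.
  by rewrite (embedding_fun (hE true)); apply: gen_app.
have [y xy Zy] : exists2 y, gen r x y &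
    hull (\bigcup_k (h k @` Z k)) y.
  elim: AC'x => [y [[i _ <-]|C'y]|f c _ IH].
  - exists (h false (val i)); first by apply: gen_base; right; exists i.
    apply: hull_base; exists false => //; exists (val i) => //.
    by apply: hull_base; left; exact/set_mem/valP.
  - exists (h true y); first exact/genD/C'D.
    by apply: hull_base; exists true => //; exists y => //; exact: hull_base.
  - have /choice[d dP] i : exists y,
        gen r (c i) y /\ hull (\bigcup_k (h k @` Z k)) y.
      by have [y] := IH i; exists y.
    exists (finterp Q f d); first by apply: gen_app => i; have [] := dP i.
    by apply: hull_app => i; have [] := dP i.
(* The partial isomorphism agrees with [h true] on the closure of [D]. *)
have yE : y = h true x.
  exact/(partial_iso_eq (partial_iso_gen rE) xy (genD _ Dx)).
apply: (h_hull Z _ _ true); last by rewrite -yE.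
  by case; exact: hull_sub.
move=> [] [] z [Zz Sz] //.
  by apply: hull_base; right.
have : hull (hull C' `&` S) z.
  apply: MAB => [w Cw|w []|] //.
  by split; apply: hull_base; [exact: CC'|right].
by move/(hull_sub (@subIsetl _ _ _)).
Qed.

Lemma extension_indep_d : extension kappa (@indep_d L M).
Proof.
move=> A B C B' smallA smallB smallC smallB' dAB.
have MAB := indep_d_M smallB smallC dAB.
have [A' [AA' MA']] := extension_indep_M smallA smallB smallC smallB' MAB.
by exists A'; split=> //; exact: indep_M_d.
Qed.

(** * Invariance and forcing extension *)

Lemma indep_d_equiv A A' B C : equiv_over (B `|` C) A A' ->
  indep_d C A' B -> indep_d C A B.
Proof.
move=> [I [e [e' [<- <- /tp_satP ee']]]] dAB n m phi a b ea bBC satab.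
have /choice[i iE] k : exists i, e i = a k by have [i _] := ea k; exists i.
apply: (dAB n m phi (e' \o i)) => //.
pose c (z : 'I_n + 'I_m) : I + (B `|` C) := match z with
  | inl k => inl (i k) | inr k => inr (SigSub (mem_set (bBC k))) end.
have satE (d : I -> M) :
    sat phi (sjoin (d \o i) b) <-> sat (fmap c phi) (sjoin d val).
  by rewrite sat_fmap; apply: sat_ext => -[].
apply/satE/ee'/satE.
by have -> : e \o i = a by apply/funext.
Qed.

(** The partial isomorphism that carries one enumeration to the other fixes the closure of [B] and
    [C] pointwise, so a point of the intersection for [A] is also one for [A']. *)
Lemma indep_M_equiv A A' B C : equiv_over (B `|` C) A A' ->
  indep_M C A' B -> indep_M C A B.
Proof.
move=> [I [e [e' [<- <- /tp_satP ee']]]] /indep_MP MAB.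
apply/indep_MP => C' CC' C'BC x [eC'x BCx].
apply: (MAB C' CC' C'BC); split=> //.
pose r u v := (B `|` C) u /\ v = u \/ exists2 i, u = e i & v = e' i.
have rE : elem_rel r.
  move=> n phi v w vw.
  have /choice[c cP] k : exists c : I + (B `|` C),
      v k = sjoin e val c /\ w k = sjoin e' val c.
    have [[Bv ->]|[i -> ->]] := vw k; last by exists (inl i).
    by exists (inr (SigSub (mem_set Bv))).
  have -> : v = sjoin e val \o c by apply/funext => k; have [] := cP k.
  have -> : w = sjoin e' val \o c by apply/funext => k; have [] := cP k.
  by rewrite -!sat_fmap.
have genBC y : hull (B `|` C) y -> gen r y y.
  by elim=> [{}y By|f a _ IH]; [apply: gen_base; left|exact: gen_app].
have [y xy hy] : exists2 y, gen r x y & hull (range e' `|` C') y.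
  elim: eC'x => [y [[i _ <-]|C'y]|f a _ IH].
  - exists (e' i); first by apply: gen_base; right; exists i.
    by apply: hull_base; left; exists i.
  - by exists y; [exact/genBC/C'BC|apply: hull_base; right].
  - have /choice[d dP] i : exists y, gen r (a i) y /\ hull (range e' `|` C') y.
      by have [y] := IH i; exists y.
    exists (finterp M f d); first by apply: gen_app => i; have [] := dP i.
    by apply: hull_app => i; have [] := dP i.
suff -> : x = y by [].
exact/(partial_iso_eq (partial_iso_gen rE) (genBC _ BCx) xy).
Qed.

(** One direction is extension. For the other, the instance [Bhat = B] gives an independent set
    equivalent to [A], and invariance returns to [A]. *)
Lemma force_extensionP (R : set M -> set M -> set M -> Prop) A B C :
  extension kappa R ->
  (forall A A' B C, equiv_over (B `|` C) A A' -> R C A' B -> R C A B) ->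
  small kappa A -> small kappa B -> small kappa C ->
  R C A B <-> force_extension kappa R C A B.
Proof.
move=> Rext Rinv smallA smallB smallC; split=> [RAB Bh smallBh BBh|RAB].
  have [A' [AA' RA']] := Rext A B C Bh smallA smallB smallC smallBh RAB.
  by exists A'; split=> //; move/setUidPr: BBh => <-.
have [A' [AA' RA']] := RAB B smallB (@subset_refl _ B).
exact: Rinv RA'.
Qed.

End Monster.

Theorem proposition3p18 (L : language) (T : theory L)
    (hT : model_companion T set0) (kappa : Type) (M : structure L)
    (hM : monster kappa T M) :
  [/\ extension kappa (@indep_M L M),
      extension kappa (@indep_d L M),
      (forall A B C : set M,
         small kappa A -> small kappa B -> small kappa C ->
         (indep_M C A B <-> indep_thorn kappa C A B))
    & (forall A B C : set M,
         small kappa A -> small kappa B -> small kappa C ->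
         (indep_d C A B <-> indep_f kappa C A B))].
Proof.
have [TM smallL satM _] := hM.
have nat_small : small kappa [set: nat].
  apply: small_card_le smallL; apply/card_le_relP.
  exists (fun n z => z = inr n); split=> [n _|n n' _ _ _ -> [//]].
  by exists (inr n).
have extM := extension_indep_M hT TM nat_small satM.
have extd := extension_indep_d hT TM nat_small satM.
split=> // A B C; apply: force_extensionP => // ? ? ? ?.
- exact: (indep_M_equiv hT TM nat_small satM).
- exact: indep_d_equiv.
Qed.
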